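(* Let $n\geq3$ and $i,j\in[n]$. Consider the thin Schubert cells $\mathbb{F}_{\mathbf{M}}$ of $\mathbb{F}_{1<n-1}(\mathbb{C}^n)$, indexed by the plurimatroids $\mathbf{M}=(M_1,M_2)\in\mathcal{M}^{1,n-1}_n$, where $\mathcal{B}_1,\mathcal{B}_2$ denote the sets of bases of $M_1,M_2$. Let $C=\{\mathbb{F}_{\mathbf{M}}:\mathbb{F}_{\mathbf{M}}\text{ is complete}\}$, $P=\{\mathbb{F}_{\mathbf{M}}:\mathbb{F}_{\mathbf{M}}\text{ is proper}\}$, $E=\{\mathbb{F}_{\mathbf{M}}:\mathbb{F}_{\mathbf{M}}\text{ is empty}\}$, and define $$C(i,j)=\{\mathbb{F}_{\mathbf{M}}\in C:|\mathcal{B}_1|=i\text{ and }|\mathcal{B}_2|=j\},$$ $$P(i,j)=\{\mathbb{F}_{\mathbf{M}}\in P:|\mathcal{B}_1|=i\text{ and }|\mathcal{B}_2|=j\},$$ $$E(i,j)=\{\mathbb{F}_{\mathbf{M}}\in E:|\mathcal{B}_1|=i\text{ and }|\mathcal{B}_2|=j\}.$$ Then: (1) $|C(i,j)|=\binom{n}{i}\binom{n-i}{j}$. (2) $|P(i,j)|=\binom{n}{i}\left[\binom{n}{j}-\binom{n-i}{j}-i\binom{n-i}{j-1}\right]$. (3) $|E(i,j)|=i\binom{n}{i}\binom{n-i}{j-1}$.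
   Context: Binomial coefficients $\binom{a}{b}$ with $b>a\ge0$ are $0$. $[n]=\{1,\dots,n\}$ and $\binom{[n]}{d}$ is the set of $d$-element subsets of $[n]$. A matroid of rank $d$ on $n$ elements is a pair $M=([n],\mathcal{B})$ with $\emptyset\neq\mathcal{B}\subset\binom{[n]}{d}$ such that for all $I,J\in\mathcal{B}$ and $i\in I\setminus J$ there is $j\in J\setminus I$ with $(I\setminus\{i\})\cup\{j\}\in\mathcal{B}$; the elements of $\mathcal{B}$ are its bases. $\mathcal{M}^d_n$ is the set of such matroids and $\mathcal{M}^{1,n-1}_n=\mathcal{M}^1_n\times\mathcal{M}^{n-1}_n$; its elements are called plurimatroids. $G(d,n)$ is the Grassmannian of $d$-dimensional subspaces of $\mathbb{C}^n$ with Plücker coordinates $(p_I)$; for $M=([n],\mathcal{B})\in\mathcal{M}^d_n$, $G_M=\{W\in G(d,n):p_I(W)\neq0\Leftrightarrow I\in\mathcal{B}\}$. $\mathbb{F}_{1<n-1}(\mathbb{C}^n)=\{(W_1,W_2)\in G(1,n)\times G(n-1,n):W_1\subset W_2\}$ and, for $\mathbf{M}=(M_1,M_2)$, $\mathbb{F}_{\mathbf{M}}=(G_{M_1}\times G_{M_2})\cap\mathbb{F}_{1<n-1}(\mathbb{C}^n)$. The cell $\mathbb{F}_{\mathbf{M}}$ is called complete if $\mathbb{F}_{\mathbf{M}}=G_{M_1}\times G_{M_2}$, and proper if $\mathbb{F}_{\mathbf{M}}\subsetneq G_{M_1}\times G_{M_2}$.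
   Formalization: P consists of the nonempty proper cells (with empty cells counted as proper, (2) fails for n=3, i=j=1), and cells are counted by their index M, so that distinct plurimatroids with empty cell count separately in E(i,j). *)

(* Defs.v *)
From HB Require Import structures.
From mathcomp Require Import all_boot all_order all_algebra.
From mathcomp Require Import boolp classical_sets reals.

Set Implicit Arguments.
Unset Strict Implicit.
Unset Printing Implicit Defensive.

Import GRing.Theory.
Local Open Scope ring_scope.

(* The ground set [n] = {1, ..., n} is rendered as 'I_n = {0, ..., n - 1}. *)
Definition is_matroid (d n : nat) (B : {set {set 'I_n}}) : bool :=
  [&& B != finset.set0,
      [forall I in B, #|I| == d] &
      [forall I in B, forall J in B, forall i in I :\: J,
         exists j in J :\: I, (j |: (I :\ i)) \in B]].

Definition matroid (d n : nat) : Type :=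
  {B : {set {set 'I_n}} | is_matroid d B}.
HB.instance Definition _ d n := Finite.on (matroid d n).

Definition bases (d n : nat) (M : matroid d n) : {set {set 'I_n}} := sval M.

Definition plurimatroid (n : nat) : Type := (matroid 1 n * matroid n.-1 n)%type.
HB.instance Definition _ n := Finite.on (plurimatroid n).

Section Cells.
Variables (K : fieldType) (n : nat).

Definition Grassmannian (d : nat) : set {vspace 'rV[K]_n} :=
  [set W | \dim W = d]%classic.

(* The minor, on the columns indexed by I in increasing order, of the matrix
   whose rows are the basis vbasis W; only meaningful when #|I| = \dim W.
   Another basis rescales all the p_I(W) by one common nonzero factor. *)
Definition plucker (W : {vspace 'rV[K]_n}) (I : {set 'I_n}) : K :=
  \det (\matrix_(r < #|I|, c < #|I|) (vbasis W)`_r 0 (enum_val c)).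

Definition matroid_cell (d : nat) (M : matroid d n) : set {vspace 'rV[K]_n} :=
  [set W | Grassmannian d W /\
     forall I : {set 'I_n}, #|I| = d -> (plucker W I != 0 <-> I \in bases M)]%classic.

Definition flag_variety : set ({vspace 'rV[K]_n} * {vspace 'rV[K]_n}) :=
  [set W | [/\ Grassmannian 1 W.1, Grassmannian n.-1 W.2 & (W.1 <= W.2)%VS]]%classic.

Definition ambient_cell (M : plurimatroid n) :=
  (matroid_cell M.1 `*` matroid_cell M.2)%classic.

Definition flag_cell (M : plurimatroid n) :=
  (ambient_cell M `&` flag_variety)%classic.

Definition complete_cell (M : plurimatroid n) : Prop :=
  flag_cell M = ambient_cell M.

Definition proper_cell (M : plurimatroid n) : Prop :=
  (flag_cell M `<` ambient_cell M)%classic.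

Definition empty_cell (M : plurimatroid n) : Prop :=
  flag_cell M = classical_sets.set0.

(* A cell is identified with its index M: distinct plurimatroids with empty
   cells count as distinct members of E. *)
Definition cells_of_size (Q : plurimatroid n -> Prop) (i j : nat) :
    {set plurimatroid n} :=
  finset (fun M : plurimatroid n =>
    [&& `[< Q M >], #|bases M.1| == i & #|bases M.2| == j]).

Definition cells_C := cells_of_size complete_cell.

(* An empty cell is a proper subset of its (nonempty) ambient cell, but is
   counted in E only: C, P and E partition the plurimatroids. *)
Definition cells_P :=
  cells_of_size (fun M => proper_cell M /\ ~ empty_cell M).

Definition cells_E := cells_of_size empty_cell.

End Cells.

(* Main.v *)
(* A line W1 = <v> lies in the cell of M1 iff v has support
   A = {a : {a} is a basis of M1}, and a hyperplane W2, with equation u, lies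
   in the cell of M2 iff u has support B = {b : [n] \ b is a basis of M2}; the
   latter also says that the unit vector e_b is outside W2 exactly when b is in
   B.  The flag condition is the vanishing of the sum of u_k v_k over A :&: B:
   automatic if A and B are disjoint, impossible if they meet in one point, and
   both satisfiable and violable if they meet in at least two points.  As
   M |-> (A, B) is a bijection onto the pairs of nonempty sets, it remains to
   count pairs with |A| = i, |B| = j and |A :&: B| equal to 0, equal to 1, or
   at least 2. *)

Require Import Defs.
From mathcomp Require Import all_boot all_order all_algebra reals complex.
From mathcomp Require Import boolp.
From mathcomp Require classical_sets.

Set Implicit Arguments.
Unset Strict Implicit.
Unset Printing Implicit Defensive.

Import GRing.Theory.
Local Open Scope ring_scope.

(** * Plücker coordinates of lines and hyperplanes *)

(** A vector [x] in the left kernel of the minor lists the coefficients, in the basis of [W], of a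
    vector [w] that vanishes on [I]; freeness of the basis makes [w] nonzero exactly when [x] is. *)
Lemma plucker_eq0P (K : fieldType) (n : nat) (W : {vspace 'rV[K]_n})
    (I : {set 'I_n}) : \dim W = #|I| ->
  plucker W I = 0 <->
  exists w, [/\ w \in W, w != 0 & forall i, i \in I -> w 0 i = 0].
Proof.
move=> dW.
have szX : size (vbasis W) == #|I| by rewrite size_tuple dW.
pose X := Tuple szX.
have spX : <<X>>%VS = W := span_basis (vbasisP W).
have frX : free X := basis_free (vbasisP W).
have minorE (x : 'rV_#|I|) c :
    (x *m \matrix_(r < #|I|, c < #|I|) (vbasis W)`_r 0 (enum_val c)) 0 c =
    (\sum_r x 0 r *: X`_r) 0 (enum_val c).
  by rewrite mxE summxE; apply: eq_bigr => r _; rewrite !mxE.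
split=> [/eqP/det0P[x x0 xP]|[w [wW w0 wI]]].
  exists (\sum_r x 0 r *: X`_r); split.
  - rewrite -spX; apply: memv_suml => r _; apply: memvZ; apply: memv_span.
    by apply: mem_nth; rewrite (eqP szX).
  - move/freeP: frX => frX; apply: contra_neq x0 => /frX x0.
    by apply/rowP=> r; rewrite x0 mxE.
  - move=> i iI; rewrite -(enum_rankK_in iI iI) -minorE xP mxE //.
apply/eqP/det0P; exists (\row_r coord X r w).
  apply: contra_neq w0 => /rowP c0.
  rewrite -spX in wW; rewrite (coord_span wW) big1 // => r _.
  by have := c0 r; rewrite !mxE => ->; rewrite scale0r.
apply/rowP=> c; rewrite minorE [RHS]mxE -(wI _ (enum_valP c)).
rewrite -spX in wW; rewrite [in RHS](coord_span wW).
by congr (fun_of_matrix _ _ _); apply: eq_bigr => r _; rewrite mxE.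
Qed.

Lemma plucker_line (K : fieldType) (n : nat) (v : 'rV[K]_n) (a : 'I_n) :
  v != 0 -> (plucker <[v]>%VS [set a] != 0) = (v 0 a != 0).
Proof.
move=> v0; congr negb; apply/eqP/eqP => [|va].
  case/plucker_eq0P; first by rewrite dim_vline v0 cards1.
  move=> w [/vlineP[c ->]]; rewrite scaler_eq0 (negPf v0) orbF => c0.
  move=> /(_ a (set11 a)) /eqP.
  by rewrite mxE mulf_eq0 (negPf c0) => /eqP.
apply/plucker_eq0P; first by rewrite dim_vline v0 cards1.
by exists v; split; rewrite ?memv_line // => i /set1P ->.
Qed.

(** A vector that vanishes off [b] is a multiple of the unit vector at [b], so [plucker_eq0P] has
    only this one direction to test. *)
Lemma plucker_hyperplane (K : fieldType) (n : nat) (W : {vspace 'rV[K]_n})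
    (b : 'I_n) : \dim W = n.-1 ->
  (plucker W [set~ b] != 0) = (delta_mx 0 b \notin W).
Proof.
move=> dW; congr negb.
have dWb : \dim W = #|[set~ b]| by rewrite cardsC1 card_ord.
apply/eqP/idP => [/(plucker_eq0P dWb)[w [wW w0 wb]]|bW].
  have wE : w = w 0 b *: delta_mx 0 b.
    apply/rowP=> k; rewrite !mxE eqxx /=; have [->|kb] := eqVneq k b.
      by rewrite mulr1.
    by rewrite mulr0 wb // !inE.
  have wb0 : w 0 b != 0 by apply: contra_neq w0 => wb0; rewrite wE wb0 scale0r.
  by rewrite -[delta_mx 0 b](scalerK wb0) -wE memvZ.
apply/(plucker_eq0P dWb); exists (delta_mx 0 b); split=> //.
  by apply/eqP=> /rowP/(_ b)/eqP; rewrite !mxE !eqxx oner_eq0.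
by move=> k; rewrite !inE => /negPf kb; rewrite mxE eqxx kb.
Qed.

(** * Hyperplanes given by an equation *)

Definition hyperplane (K : fieldType) (n : nat) (u : 'rV[K]_n) :
    {vspace 'rV[K]_n} := lker (linfun (mulmxr u^T)).

Lemma mem_hyperplane (K : fieldType) (n : nat) (u w : 'rV[K]_n) :
  (w \in hyperplane u) = (\sum_k w 0 k * u 0 k == 0).
Proof.
have uE : (w *m u^T) 0 0 = \sum_k w 0 k * u 0 k.
  by rewrite mxE; apply: eq_bigr => k _; rewrite mxE.
rewrite memv_ker lfunE /= -uE; apply/eqP/eqP => [->|w0]; first by rewrite mxE.
by apply/rowP=> c; rewrite ord1 w0 mxE.
Qed.

Lemma delta_mem_hyperplane (K : fieldType) (n : nat) (u : 'rV[K]_n) b :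
  (delta_mx 0 b \in hyperplane u) = (u 0 b == 0).
Proof.
rewrite mem_hyperplane (bigD1 b) //= big1 => [|k /negPf kb].
  by rewrite mxE !eqxx mul1r addr0.
by rewrite mxE kb andbF mul0r.
Qed.

(** Rank-nullity: the pairing with [u] takes values in a line, and it is nonzero on the unit vector
    at any [b] with [u 0 b] nonzero. *)
Lemma dim_hyperplane (K : fieldType) (n : nat) (u : 'rV[K]_n) :
  u != 0 -> \dim (hyperplane u) = n.-1.
Proof.
move=> u0; set f : 'Hom('rV[K]_n, 'rV[K]_1) := linfun (mulmxr u^T).
have dn : \dim {: 'rV[K]_n} = n by rewrite dimvf dim_matrix; exact: mul1n.
have := limg_ker_dim f fullv; rewrite capfv dn.
have -> : \dim (limg f) = 1%N; last by rewrite addn1 => /(congr1 predn).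
apply/eqP; rewrite eqn_leq; apply/andP; split.
  by rewrite (leq_trans (dimvS (subvf _))) // dimvf dim_matrix.
rewrite lt0n dimv_eq0 -lkerE; apply: contra_neqN u0 => /subvP kf.
apply/rowP=> b; have := kf (delta_mx 0 b) (memvf _).
by rewrite -/(hyperplane u) delta_mem_hyperplane mxE => /eqP.
Qed.

(** For use after [row_sum_delta]: membership of a vector, or of part of it, is checked on the unit
    vectors of its support. *)
Lemma row_sum_mem (K : fieldType) (n : nat) (W : {vspace 'rV[K]_n})
    (v : 'rV[K]_n) (P : pred 'I_n) :
  (forall k, P k -> v 0 k != 0 -> delta_mx 0 k \in W) ->
  \sum_(k | P k) v 0 k *: delta_mx 0 k \in W.
Proof.
move=> vW; apply: memv_suml => k Pk.
by have [->|vk] := eqVneq (v 0 k) 0; rewrite ?scale0r ?mem0v // memvZ // vW.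
Qed.

(** * Plurimatroids as pairs of nonempty sets *)

(* The nonloops of M1, and the elements of [n] that are not coloops of M2. *)
Definition supp1 (n : nat) (M : plurimatroid n) : {set 'I_n} :=
  [set a | [set a] \in bases M.1].
Definition supp2 (n : nat) (M : plurimatroid n) : {set 'I_n} :=
  [set b | [set~ b] \in bases M.2].

(** The complement of [I] has one element. For [n = 0] the truncated [n.-1] is 0 and the empty set
    would be a counterexample. *)
Lemma card_pred_setC1 (n : nat) (I : {set 'I_n}) : (0 < n)%N ->
  #|I| = n.-1 -> exists b, I = [set~ b].
Proof.
move=> n0 cI; have /eqP/cards1P[b Ib] : #|~: I| = 1%N.
  by apply/eqP; rewrite -(eqn_add2l n.-1) -{1}cI cardsC card_ord addn1 prednK.
by exists b; rewrite -Ib setCK.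
Qed.

Lemma basis_card (d n : nat) (M : matroid d n) I : I \in bases M -> #|I| = d.
Proof.
by case: M => B BM /= IB; case/and3P: (BM) => _ /forall_inP/(_ I IB)/eqP.
Qed.

Lemma bases_supp1 (n : nat) (M : plurimatroid n) :
  bases M.1 = [set [set a] | a in supp1 M].
Proof.
apply/setP=> I; apply/idP/imsetP => [IB|[a]]; last by rewrite inE => ? ->.
have /eqP/cards1P[a Ia] := basis_card IB.
by exists a => //; rewrite inE -Ia.
Qed.

Lemma bases_supp2 (n : nat) (M : plurimatroid n) : (0 < n)%N ->
  bases M.2 = [set [set~ b] | b in supp2 M].
Proof.
move=> n0; apply/setP=> I; apply/idP/imsetP => [IB|[b]]; last first.
  by rewrite inE => ? ->.
have [b Ib] := card_pred_setC1 n0 (basis_card IB).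
by exists b => //; rewrite inE -Ib.
Qed.

Lemma bases_neq0 (d n : nat) (M : matroid d n) : bases M != finset.set0.
Proof. by case: M => B BM /=; case/and3P: (BM). Qed.

Lemma card_bases1 (n : nat) (M : plurimatroid n) : #|bases M.1| = #|supp1 M|.
Proof. by rewrite bases_supp1 card_imset //; apply: set1_inj. Qed.

Lemma setC1_inj (T : finType) : injective (fun x : T => [set~ x]).
Proof. by move=> x y /setC_inj /set1_inj. Qed.

Lemma card_bases2 (n : nat) (M : plurimatroid n) : (0 < n)%N ->
  #|bases M.2| = #|supp2 M|.
Proof.
by move=> n0; rewrite bases_supp2 // card_imset //; apply: setC1_inj.
Qed.

Lemma is_matroid_set1 (n : nat) (A : {set 'I_n}) : A != finset.set0 ->
  is_matroid 1 [set [set a] | a in A].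
Proof.
move=> A0; apply/and3P; split.
- by rewrite imset_eq0.
- by apply/forall_inP=> _ /imsetP[a _ ->]; rewrite cards1.
apply/forall_inP=> _ /imsetP[a aA ->]; apply/forall_inP=> _ /imsetP[b bA ->].
apply/forall_inP=> i /setDP[/set1P-> /set1P ab].
apply/exists_inP; exists b.
  by rewrite !inE eqxx andbT eq_sym; apply/eqP.
by rewrite setDv setU0 imset_f.
Qed.

Lemma is_matroid_setC1 (n : nat) (A : {set 'I_n}) : A != finset.set0 ->
  is_matroid n.-1 [set [set~ a] | a in A].
Proof.
move=> A0; apply/and3P; split.
- by rewrite imset_eq0.
- by apply/forall_inP=> _ /imsetP[a _ ->]; rewrite cardsC1 card_ord.
apply/forall_inP=> _ /imsetP[a aA ->]; apply/forall_inP=> _ /imsetP[b bA ->].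
(* The difference of the two bases is the single point [b], so the exchange is forced: [b] leaves
   and [a] enters. *)
apply/forall_inP=> i; rewrite !inE negbK => /andP[/eqP-> ba].
apply/exists_inP; exists a; first by rewrite !inE eqxx eq_sym ba.
suff -> : a |: [set~ a] :\ b = [set~ b] by apply: imset_f.
apply/setP=> k; rewrite !inE; have [->|] := eqVneq k a => /=.
  by rewrite eq_sym ba.
by rewrite andbT.
Qed.

Definition supports (n : nat) (M : plurimatroid n) := (supp1 M, supp2 M).

Lemma supports_inj (n : nat) : (0 < n)%N -> injective (@supports n).
Proof.
move=> n0 M N [e1 e2].
have b1 : bases M.1 = bases N.1 by rewrite !bases_supp1 e1.
have b2 : bases M.2 = bases N.2 by rewrite !bases_supp2 // e2.
case: M N {e1 e2} b1 b2 => [M1 M2] [N1 N2] /= b1 b2.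
by congr (_, _); apply: val_inj.
Qed.

Lemma supports_surj (n : nat) (A B : {set 'I_n}) :
  A != finset.set0 -> B != finset.set0 ->
  exists M : plurimatroid n, supports M = (A, B).
Proof.
move=> A0 B0.
exists (Sub _ (is_matroid_set1 A0) : matroid 1 n,
        Sub _ (is_matroid_setC1 B0) : matroid n.-1 n).
congr (_, _); apply/setP=> k; rewrite inE.
- exact: (mem_imset _ _ set1_inj).
- exact: (mem_imset _ _ (@setC1_inj _)).
Qed.

Lemma supp1_neq0 (n : nat) (M : plurimatroid n) : supp1 M != finset.set0.
Proof. by have := bases_neq0 M.1; rewrite bases_supp1 imset_eq0. Qed.

Lemma supp2_neq0 (n : nat) (M : plurimatroid n) : (0 < n)%N ->
  supp2 M != finset.set0.
Proof.
by move=> n0; have := bases_neq0 M.2; rewrite bases_supp2 // imset_eq0.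
Qed.

(** * Cells in terms of supports *)

Lemma matroid_cell1P (K : fieldType) (n : nat) (M : plurimatroid n)
    (W : {vspace 'rV[K]_n}) :
  matroid_cell M.1 W <->
  exists2 v, W = <[v]>%VS & forall a, (v 0 a != 0) = (a \in supp1 M).
Proof.
split=> [[dW pW]|[v -> vA]].
  have W1 : \dim W == 1%N by apply/eqP.
  have v0 : vpick W != 0 by rewrite vpick0 -dimv_eq0 (eqP W1).
  have WE : W = <[vpick W]>%VS.
    apply/esym/eqP.
    by rewrite eqEdim dim_vline v0 (eqP W1) andbT -memvE memv_pick.
  exists (vpick W) => // a; rewrite -plucker_line // -WE inE.
  by apply/idP/idP => /(pW _ (cards1 a)).
have v0 : v != 0.
  have /set0Pn[a aA] := supp1_neq0 M; apply: contraTneq aA => v0.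
  by rewrite -vA v0 mxE eqxx.
split=> [|I /eqP/cards1P[a ->]]; first by rewrite /Grassmannian /= dim_vline v0.
by rewrite plucker_line // vA inE.
Qed.

Lemma matroid_cell2P (K : fieldType) (n : nat) (M : plurimatroid n)
    (W : {vspace 'rV[K]_n}) : (0 < n)%N ->
  matroid_cell M.2 W <->
  \dim W = n.-1 /\ forall b, (delta_mx 0 b \notin W) = (b \in supp2 M).
Proof.
move=> n0; split=> [[dW pW]|[dW vA]].
  split=> // b; rewrite -plucker_hyperplane // inE.
  by apply/idP/idP => /pW; apply; rewrite cardsC1 card_ord.
split=> // I cI.
have [b ->] := card_pred_setC1 n0 cI.
by rewrite plucker_hyperplane // vA inE.
Qed.

Lemma matroid_cell2_hyperplane (K : fieldType) (n : nat) (M : plurimatroid n)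
    (u : 'rV[K]_n) : (0 < n)%N -> (forall b, (u 0 b != 0) = (b \in supp2 M)) ->
  matroid_cell M.2 (hyperplane u).
Proof.
move=> n0 uB; apply/(matroid_cell2P _ _ n0); split.
  apply: dim_hyperplane; have /set0Pn[b bB] := supp2_neq0 M n0.
  by apply: contraTneq bB => u0; rewrite -uB u0 mxE eqxx.
by move=> b; rewrite delta_mem_hyperplane uB.
Qed.

Definition indicator (K : fieldType) (n : nat) (A : {set 'I_n}) : 'rV[K]_n :=
  \row_a (a \in A)%:R.

Lemma indicator_neq0 (K : fieldType) (n : nat) (A : {set 'I_n}) a :
  (indicator K A 0 a != 0) = (a \in A).
Proof. by rewrite mxE; case: (a \in A); rewrite ?oner_eq0 ?eqxx. Qed.

(** Supplies the test points of the ambient cell: the line is fixed, and the equation [u] of the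
    hyperplane remains free within its support. *)
Lemma ambient_cell_indicator (K : fieldType) (n : nat) (M : plurimatroid n)
    (u : 'rV[K]_n) : (0 < n)%N -> (forall b, (u 0 b != 0) = (b \in supp2 M)) ->
  ambient_cell M (<[indicator K (supp1 M)]>%VS, hyperplane u).
Proof.
move=> n0 uB; split; last exact: matroid_cell2_hyperplane.
apply/matroid_cell1P; exists (indicator K (supp1 M)) => // a.
exact: indicator_neq0.
Qed.

Lemma indicator_sub_hyperplane (K : fieldType) (n : nat) (A : {set 'I_n})
    (u : 'rV[K]_n) :
  (<[indicator K A]> <= hyperplane u)%VS = (\sum_(k in A) u 0 k == 0).
Proof.
rewrite -memvE mem_hyperplane [in RHS]big_mkcond; congr (_ == _).
by apply: eq_bigr => k _; rewrite mxE; case: (k \in A); rewrite ?mul1r ?mul0r.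
Qed.

Lemma flag_cellP (K : fieldType) (n : nat) (M : plurimatroid n)
    (W : {vspace 'rV[K]_n} * {vspace 'rV[K]_n}) :
  flag_cell M W <-> ambient_cell M W /\ (W.1 <= W.2)%VS.
Proof.
split=> [[aW [_ _ sW]]|[aW sW]]; first by split.
by split=> //; case: aW => [[d1 _] [d2 _]]; split.
Qed.

(** * Complete and empty cells by the size of the intersection *)

(** The two indicator vectors pair to the size of the intersection, which vanishes in characteristic
    0 only if the supports are disjoint. Conversely, disjointness puts every unit vector from the
    support of [v] into the hyperplane. *)
Lemma complete_cellP (K : numFieldType) (n : nat) (M : plurimatroid n) :
  (0 < n)%N -> complete_cell K M <-> #|supp1 M :&: supp2 M| = 0%N.
Proof.
move=> n0; split=> [cM|/cards0_eq/setP AB].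
  have /(ambient_cell_indicator n0) := @indicator_neq0 K n (supp2 M).
  rewrite -cM => /flag_cellP[_]; rewrite indicator_sub_hyperplane /=.
  have -> : \sum_(k in supp1 M) indicator K (supp2 M) 0 k =
            #|supp1 M :&: supp2 M|%:R.
    rewrite -sum1_card natr_sum big_mkcond [RHS]big_mkcond.
    by apply: eq_bigr => k _; rewrite mxE in_setI; do 2 case: (_ \in _).
  by rewrite Num.Theory.pnatr_eq0 => /eqP.
apply/classical_sets.seteqP; split=> W; first by case/flag_cellP.
move=> aW; apply/flag_cellP; split=> //.
case: aW => /matroid_cell1P[v -> vA] /(matroid_cell2P _ _ n0)[_ WB].
rewrite -memvE [v]row_sum_delta; apply: row_sum_mem => k _.
by rewrite vA => kA; have := AB k; rewrite in_setI in_set0 kA -WB => /negbFE.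
Qed.

(** The entry at [a] is chosen to cancel the ones at the other points of [A :&: B]. *)
Lemma sum_balanced_eq0 (K : numFieldType) (n : nat) (A B : {set 'I_n}) a :
  a \in A :&: B ->
  \sum_(k in A) (if k == a then 1 - #|A :&: B|%:R else (k \in B)%:R) = 0 :> K.
Proof.
move=> aAB; have /setIP[aA aB] := aAB.
rewrite (bigD1 a) //= eqxx (cardsD1 a (A :&: B)) aAB natrD opprD addrA subrr.
rewrite add0r.
apply/eqP; rewrite addrC subr_eq0 -sum1_card natr_sum; apply/eqP.
rewrite big_mkcond [RHS]big_mkcond; apply: eq_bigr => k _.
rewrite !inE; case: eqVneq => //=; rewrite ?andbF //.
by case: (k \in A); case: (k \in B).
Qed.

Lemma empty_cellP (K : numFieldType) (n : nat) (M : plurimatroid n) :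
  (0 < n)%N -> empty_cell K M <-> #|supp1 M :&: supp2 M| = 1%N.
Proof.
move=> n0; split=> [eM|/eqP/cards1P[a ABa]].
  have [AB0|/set0Pn[a aAB]] := eqVneq (supp1 M :&: supp2 M) finset.set0.
    have cM : complete_cell K M by apply/complete_cellP; rewrite // AB0 cards0.
    have /(ambient_cell_indicator n0) := @indicator_neq0 K n (supp2 M).
    by rewrite -cM eM.
  apply/eqP; apply: contraT => AB1.
  (* With at least two common points, the balanced equation yields a flag. Its entry at [a] is
     nonzero in characteristic 0 because the intersection does not have size 1, so [u] has the right
     support. *)
  pose u : 'rV[K]_n :=
    \row_k (if k == a then 1 - #|supp1 M :&: supp2 M|%:R
            else (k \in supp2 M)%:R).
  have uB b : (u 0 b != 0) = (b \in supp2 M).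
    rewrite mxE; have [->|_] := eqVneq b a.
      have /setIP[_ ->] := aAB; rewrite subr_eq0 eq_sym.
      by rewrite -[1]/(1%:R) Num.Theory.eqr_nat AB1.
    by case: (b \in _); rewrite ?oner_eq0 ?eqxx.
  have aW := ambient_cell_indicator n0 uB.
  suff : flag_cell M (<[indicator K (supp1 M)]>%VS, hyperplane u).
    by rewrite eM.
  apply/flag_cellP; split=> //=; rewrite indicator_sub_hyperplane.
  apply/eqP; rewrite -[RHS](sum_balanced_eq0 K aAB).
  by apply: eq_bigr => k _; rewrite mxE.
apply/classical_sets.seteqP; split=> // W.
move=> /flag_cellP[[/matroid_cell1P[v -> vA]] /(matroid_cell2P _ _ n0)[_ WB]].
rewrite -memvE => vW.
have /setIP[aA aB] : a \in supp1 M :&: supp2 M by rewrite ABa set11.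
move: aB; rewrite -WB => /negP; apply; move: vW.
(* All terms of [v] other than the one at [a] lie in the hyperplane; hence so does the unit vector
   at [a], against [a \in supp2 M]. *)
rewrite [v in v \in _]row_sum_delta (bigD1 a) //= rpredDr.
  by rewrite rpredZeq -[_ == 0]negbK vA aA.
apply: row_sum_mem => k ka; rewrite vA => kA; apply: contraNT ka.
by rewrite WB => kB; rewrite -in_set1 -ABa inE kA.
Qed.

(** * Counting pairs of sets by the size of their intersection *)

(** The map sending [B] to [(A :&: B, B :\: A)] is a bijection onto pairs of a [k]-subset of [A] and
    a [(j - k)]-subset of its complement. *)
Lemma card_draws_meet (T : finType) (A : {set T}) (j k : nat) : (k <= j)%N ->
  #|[set B : {set T} | (#|B| == j) && (#|A :&: B| == k)]| =
  ('C(#|A|, k) * 'C(#|T| - #|A|, j - k))%N.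
Proof.
move=> kj; rewrite -[in RHS](setCK A) -cardsCs setCK -!cards_draws -cardsX.
have sI : injective (fun B : {set T} => (A :&: B, B :\: A)).
  move=> B C [IE DE].
  by rewrite -(setID B A) -(setID C A) DE ![_ :&: A]setIC IE.
rewrite -(card_imset _ sI); apply: eq_card => -[B C].
rewrite in_setX !in_set; apply/imsetP/andP => /= [[D]|].
  rewrite inE => /andP[/eqP cD /eqP cI] [-> ->].
  by rewrite subsetIl setDE subsetIr -setDE cardsD [D :&: A]setIC cD cI !eqxx.
move=> [/andP[BA /eqP cB] /andP[CA /eqP cC]].
have AC0 : A :&: C = finset.set0.
  by apply/eqP; rewrite setIC setI_eq0 disjoints_subset.
have BA0 : B :\: A = finset.set0 by apply/eqP; rewrite setD_eq0.
have IE : A :&: (B :|: C) = B by rewrite setIUr AC0 setU0; apply/setIidPr.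
have DE : (B :|: C) :\: A = C.
  by rewrite setDUl BA0 set0U setDE; apply/setIidPl.
exists (B :|: C); last by rewrite IE DE.
by rewrite inE -(cardsID A) [_ :&: A]setIC IE DE cB cC subnKC ?eqxx.
Qed.

Lemma card_pairs (T : finType) (p : rel {set T}) (i m : nat) :
  (forall A : {set T}, #|A| = i -> #|[set B | p A B]| = m) ->
  #|[set AB : {set T} * {set T} | (#|AB.1| == i) && p AB.1 AB.2]| =
  ('C(#|T|, i) * m)%N.
Proof.
move=> pm; rewrite -card_draws -sum_nat_const -sum1_card.
under eq_bigl => AB do rewrite inE.
rewrite -(pair_big_dep (fun A : {set T} => #|A| == i) p (fun _ _ => 1%N)) /=.
apply: eq_big => [A|A /eqP cA]; first by rewrite inE.
by rewrite -(pm A cA) -sum1_card; apply: eq_bigl => B; rewrite inE.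
Qed.

(** Transports the count along [supports]; positivity of [i] and [j] ensures that every pair of sets
    counted is nonempty and so comes from a plurimatroid. *)
Lemma card_cells_of_size (n i j m : nat) (Q : plurimatroid n -> Prop)
    (p : pred nat) : (0 < n)%N -> (0 < i)%N -> (0 < j)%N ->
  (forall M, Q M <-> p #|supp1 M :&: supp2 M|) ->
  (forall A : {set 'I_n}, #|A| = i ->
     #|[set B : {set 'I_n} | (#|B| == j) && p #|A :&: B|]| = m) ->
  #|cells_of_size Q i j| = ('C(n, i) * m)%N.
Proof.
move=> n0 i0 j0 Qp pm; rewrite -(card_imset _ (supports_inj n0)).
rewrite -[n in 'C(n, _)]card_ord -(card_pairs pm).
apply: eq_card => -[A B]; rewrite [RHS]inE /=.
apply/imsetP/and3P => [[M]|[/eqP cA /eqP cB pAB]].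
  rewrite inE card_bases1 card_bases2 // => /and3P[/asboolP/Qp pM ? ?].
  by move=> [-> ->]; split.
have [||M ME] := @supports_surj n A B.
- by rewrite -card_gt0 cA.
- by rewrite -card_gt0 cB.
exists M => //; case: ME => AE BE.
rewrite inE card_bases1 card_bases2 // AE BE cA cB !eqxx !andbT.
by apply/asboolP/Qp; rewrite AE BE.
Qed.

(** * Proper cells and the three formulas *)

Lemma proper_cellP (K : numFieldType) (n : nat) (M : plurimatroid n) :
  proper_cell K M <-> ~ complete_cell K M.
Proof.
have fa : classical_sets.subset (@flag_cell K n M) (@ambient_cell K n M).
  by move=> W /flag_cellP[].
split=> [[_ naf] cM|ncM]; first by apply: naf; rewrite cM.
by split=> // af; apply: ncM; apply/classical_sets.seteqP.
Qed.

(* The complex numbers are R[i] for R a realType. *)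
Theorem corollary5p9 (R : realType) (n i j : nat)
    (hn : (3 <= n)%N) (hi : (1 <= i <= n)%N) (hj : (1 <= j <= n)%N) :
  [/\ #|cells_C (R[i]%C : fieldType) n i j| = ('C(n, i) * 'C(n - i, j))%N,
      #|cells_P (R[i]%C : fieldType) n i j|%:Z =
        'C(n, i)%:Z * ('C(n, j)%:Z - 'C(n - i, j)%:Z - i%:Z * 'C(n - i, j - 1)%:Z)
    & #|cells_E (R[i]%C : fieldType) n i j| = (i * 'C(n, i) * 'C(n - i, j - 1))%N].
Proof.
have n0 : (0 < n)%N by apply: leq_trans hn.
have [/andP[i0 _] /andP[j0 _]] := (hi, hj).
have cC (A : {set 'I_n}) : #|A| = i ->
    #|[set B : {set 'I_n} | (#|B| == j) && (#|A :&: B| == 0)]| = 'C(n - i, j).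
  by move=> cA; rewrite card_draws_meet // bin0 mul1n subn0 card_ord cA.
have cE (A : {set 'I_n}) : #|A| = i ->
    #|[set B : {set 'I_n} | (#|B| == j) && (#|A :&: B| == 1)]| =
    (i * 'C(n - i, j - 1))%N.
  by move=> cA; rewrite card_draws_meet // bin1 card_ord cA.
(* The [j]-subsets are split by how they meet [A]; the additive form avoids truncated
   subtraction. *)
have cP (A : {set 'I_n}) : #|A| = i ->
    (#|[set B : {set 'I_n} | (#|B| == j) && (1 < #|A :&: B|)%N]| +
     (i * 'C(n - i, j - 1)) + 'C(n - i, j))%N = 'C(n, j).
  move=> cA; rewrite -(cE A cA) -(cC A cA) -[in RHS](card_ord n) -card_draws.
  rewrite -!sum1dep_card -addnA.
  rewrite [RHS](bigID (fun B : {set 'I_n} => 1 < #|A :&: B|)%N) /=.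
  congr (_ + _)%N.
  rewrite [RHS](bigID (fun B : {set 'I_n} => #|A :&: B| == 1)%N) /=.
  by congr (_ + _)%N; apply: eq_bigl => B;
    case: #|A :&: B| => [|[|k]]; rewrite ?andbT ?andbF.
(* A sample [i]-subset, available since [i <= n], names the count of sets [B] meeting it in at least
   two points. *)
have [A0] : exists A, A \in [set A : {set 'I_n} | #|A| == i].
  by apply/card_gt0P; rewrite card_draws card_ord bin_gt0; case/andP: hi.
rewrite inE => /eqP cA0.
have CP M := @complete_cellP (R[i]%C : numFieldType) n M n0.
have EP M := @empty_cellP (R[i]%C : numFieldType) n M n0.
split.
- apply: (@card_cells_of_size _ _ _ _ _ (fun k => k == 0%N)) => // M.
  by apply: (iff_trans (CP M)); split=> /eqP.
(* Expanding ['C(n, j)] makes the integer bracket collapse to the count for [A0]. *)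
- rewrite -(cP A0 cA0) !PoszD PoszM addrK addrK -PoszM; congr Posz.
  apply: (@card_cells_of_size _ _ _ _ _ (fun k => (1 < k)%N)) => // [M|A cA].
    rewrite proper_cellP CP EP; case: #|_| => [|[|k]].
    + by split=> // -[].
    + by split=> // -[].
    + by split.
  (* The count for [A] equals that for [A0]: both give ['C(n, j)] after adding the same two
     terms. *)
  apply: (@addIn (i * 'C(n - i, j - 1))); apply: (@addIn 'C(n - i, j)).
  by rewrite (cP A cA) (cP A0 cA0).
- rewrite [(i * _)%N]mulnC -mulnA.
  apply: (@card_cells_of_size _ _ _ _ _ (fun k => k == 1%N)) => // M.
  by apply: (iff_trans (EP M)); split=> /eqP.
Qed.
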